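(* Let $m,n\geqslant1$, $N\geqslant1$, and let $\mathcal{J}\subseteq C_{m,n}(N)$ be the annihilator of the traceless subspace $V^{m,n}_0$ in $C_{m,n}(N)$. Then $\mathscr{P}_{m,n}$ is the splitting idempotent of the short exact sequence $0\to\mathcal{J}\to C_{m,n}(N)\to C_{m,n}(N)/\mathcal{J}\to0$: namely $\mathscr{P}_{m,n}C_{m,n}(N)$ and $\mathcal{J}$ are two-sided ideals with $C_{m,n}(N)=\mathscr{P}_{m,n}C_{m,n}(N)\oplus\mathcal{J}$ as a direct sum of algebras, and $\mathscr{P}_{m,n}C_{m,n}(N)\cong C_{m,n}(N)/\mathcal{J}$ as algebras.
   Context: $V$ is an $N$-dimensional complex vector space with basis $\{e_i\}$ and dual basis $\{e^i\}$; $V^{m,n}=V^{\otimes m}\otimes V^{*\otimes n}$ with the diagonal $GL(N)$-action (contragredient on $V^*$); $C_{m,n}(N)=\mathrm{End}_{GL(N)}(V^{m,n})$. $\mathrm{tr}_{ab'}:V^{m,n}\to V^{m-1,n-1}$ contracts the $a$-th $V$-factor with the $b'$-th $V^*$-factor and $\mathrm{tr}^+_{ab'}:V^{m-1,n-1}\to V^{m,n}$ inserts $\sum_ie_i\otimes e^i$ at these positions. $V^{m,n}_0=\bigcap_{a,b'}\ker\mathrm{tr}_{ab'}$, $V^{m,n}_1$ is the span of the images of all $\mathrm{tr}^+_{ab'}$, $V^{m,n}=V^{m,n}_0\oplus V^{m,n}_1$, and the traceless projector $\mathscr{P}_{m,n}$ is the projection onto $V^{m,n}_0$ with kernel $V^{m,n}_1$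 (it belongs to $C_{m,n}(N)$). *)

(* Defs.v *)
From HB Require Import structures.
From mathcomp Require Import all_boot all_order all_algebra.
Set Implicit Arguments. Unset Strict Implicit. Unset Printing Implicit Defensive.
Import GRing.Theory Num.Theory.
Local Open Scope ring_scope.

(* Basis of V^{m,n} = V^{(x)m} (x) V*^{(x)n}, V = F^N:
   e_{I,J} = e_{I 0} (x) ... (x) e_{I (m-1)} (x) e^{J 0} (x) ... (x) e^{J (n-1)}. *)
Notation tidx m n N := ({ffun 'I_m -> 'I_N} * {ffun 'I_n -> 'I_N})%type.
Notation tdim m n N := #|{: tidx m n N}|.
(* elements of V^{m,n}: column coordinate vectors; End(V^{m,n}): matrices
   acting on the left (so composition = matrix product). *)
Notation tvec F m n N := 'cV[F]_(tdim m n N).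
Notation tend F m n N := 'M[F]_(tdim m n N).

Section Defs.
Variables (F : numClosedFieldType) (m n N : nat).

Definition tcoord (v : tvec F m n N) (x : tidx m n N) : F := v (enum_rank x) 0.

(* the diagonal GL(N)-action (contragredient on V^* ) *)
Definition rho (g : 'M[F]_N) : tend F m n N :=
  \matrix_(i, j) let x : tidx m n N := enum_val i in let y : tidx m n N := enum_val j in
    (\prod_(a < m) g (x.1 a) (y.1 a)) * \prod_(b < n) (invmx g) (y.2 b) (x.2 b).

Definition centralizer (A : tend F m n N) : Prop :=
  forall g : 'M[F]_N, g \in unitmx -> A *m rho g = rho g *m A.

Definition upd k (f : {ffun 'I_k -> 'I_N}) (a : 'I_k) (i : 'I_N) :
  {ffun 'I_k -> 'I_N} := [ffun l => if l == a then i else f l].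

Definition in_ker_tr (a : 'I_m) (b : 'I_n) (v : tvec F m n N) : Prop :=
  forall x : tidx m n N,
    \sum_(i < N) tcoord v (upd x.1 a i, upd x.2 b i) = 0.

Definition traceless (v : tvec F m n N) : Prop :=
  forall a b, in_ker_tr a b v.

(* v \in image of tr^+_{ab'} : v_{I,J} = delta(I a, J b) * S(I\a, J\b);
   s is S viewed as a function of (I,J) not depending on I a, J b. *)
Definition in_img_trplus (a : 'I_m) (b : 'I_n) (v : tvec F m n N) : Prop :=
  exists s : tidx m n N -> F,
    (forall (x : tidx m n N) i j, s (upd x.1 a i, upd x.2 b j) = s x) /\
    (forall x : tidx m n N, tcoord v x = (x.1 a == x.2 b)%:R * s x).

(* V^{m,n}_1 : span of the images of all tr^+_{ab'} (each is a subspace) *)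
Definition trace_part (v : tvec F m n N) : Prop :=
  exists w : 'I_m -> 'I_n -> tvec F m n N,
    (forall a b, in_img_trplus a b (w a b)) /\ v = \sum_(a < m) \sum_(b < n) w a b.

(* P is the projection onto V_0 with kernel V_1 (unique since V = V_0 (+) V_1) *)
Definition traceless_projector (P : tend F m n N) : Prop :=
  (forall v, traceless v -> P *m v = v) /\ (forall v, trace_part v -> P *m v = 0).

Definition annihilator_traceless (A : tend F m n N) : Prop :=
  centralizer A /\ forall v, traceless v -> A *m v = 0.

Definition left_mul_image (P : tend F m n N) (A : tend F m n N) : Prop :=
  exists c, centralizer c /\ A = P *m c.

Definition two_sided_ideal (S I : tend F m n N -> Prop) : Prop :=
  [/\ forall x, I x -> S x,
      I 0,
      forall (k : F) x y, I x -> I y -> I (k *: x + y)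
    & forall c x, S c -> I x -> I (c *m x) /\ I (x *m c)].

End Defs.

(* Main.v *)
Require Import Defs.
From HB Require Import structures.
From mathcomp Require Import all_boot all_order all_algebra perm.
Set Implicit Arguments. Unset Strict Implicit. Unset Printing Implicit Defensive.
Import GRing.Theory Num.Theory.
Local Open Scope ring_scope.

(* Let B be the matrix of all trace functionals. Since B is real, B and B B^T
   have the same column space; this gives V = V_0 (+) V_1, and the projector P
   is symmetric. So P commutes with A as soon as A and A^T preserve V_0. Both
   GL(N) and the centralizer C are stable under transposition, and the point is
   that C preserves V_0. Partial transposition turns C into the commutant of
   GL(N) on V^{(x)(m+n)}, which by Schur-Weyl duality is spanned by permutations,
   and each of the resulting walled Brauer diagrams maps V_0 to itself.

   For Schur-Weyl duality, polarization shows that a c commuting with all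
   g^{(x)T} commutes with the operators sum_s E_{ws,zs}. These are the
   coefficients of Phi(Z) = sum_s <Z, R_s> R_s, where R_s is the action of the
   permutation s, so Phi(c Z) = c Phi(Z). Phi has image span(R_s), which contains
   1 = Phi(Z); hence c = Phi(c Z) lies in this span. *)

(** * Gram matrices and polarization *)

(** If [K] is the cokernel of B^T B then, [B] being real, the conjugate transpose of BK times BK is
    zero. Its diagonal entries are sums of squared moduli, so BK = 0. *)
Lemma submx_gram (F : numClosedFieldType) r d (B : 'M[F]_(r, d)) :
  (forall i j, (B i j)^* = B i j) -> (B <= B^T *m B)%MS.
Proof.
move=> realB; rewrite submxE; set K := cokermx _.
have Y0 : (map_mx Num.conj (B *m K))^T *m (B *m K) = 0.
  rewrite map_mxM trmx_mul (_ : map_mx _ B = B); last first.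
    by apply/matrixP=> i j; rewrite mxE; apply: realB.
  by rewrite -mulmxA (mulmxA B^T) mulmx_coker mulmx0.
apply/eqP/matrixP=> i j; rewrite [RHS]mxE.
have /eqP := congr1 (fun M : 'M__ => M j j) Y0.
rewrite mxE [X in _ == X]mxE psumr_eq0 => [|k _]; last first.
  by rewrite mxE [X in X * _]mxE mulrC mul_conjC_ge0.
move/allP/(_ i (mem_index_enum i)) => /=.
by rewrite mxE [X in X * _]mxE mulrC mul_conjC_eq0 => /eqP.
Qed.

Lemma poly_eq0_horner (F : numDomainType) (p : {poly F}) :
  (forall t, p.[t] = 0) -> p = 0.
Proof.
move=> p0; apply: (@roots_geq_poly_eq0 _ p [seq i%:R | i <- iota 0 (size p)]).
- by apply/allP=> t _; apply/rootP.
- rewrite map_inj_uniq ?iota_uniq // => i j /eqP.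
  by rewrite eqr_nat => /eqP.
- by rewrite size_map size_iota.
Qed.

Lemma sum_ffun_onto (R : nmodType) (T : finType) (G : {ffun T -> T} -> R) :
  \sum_(f : {ffun T -> T} | [forall a, a \in codom f]) G f = \sum_(s : {perm T}) G (val s).
Proof.
rewrite (reindex_omap (val : {perm T} -> {ffun T -> T}) insub) => [|f /forallP f_onto].
  apply: eq_bigl => s; rewrite valK eqxx andbT.
  by apply/forallP => a; apply/injF_onto/injectiveP/(valP s).
rewrite insubT //; apply/injectiveP => x y eq_f.
have /image_injP inj_f : #|codom f| == #|T|.
  by apply/eqP/eq_card => a; rewrite f_onto.
exact: inj_f.
Qed.

(* Inclusion-exclusion over the subsets [e] of [T] isolates the terms that are
   linear in each of the families [M a]. *)
Lemma polarization (R : comPzRingType) (T : finType) (M : T -> T -> R) :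
  \sum_(e : {ffun T -> bool}) (\prod_a (-1) ^+ (~~ e a)) *
    \prod_t \sum_a (e a)%:R * M a t
  = \sum_(s : {perm T}) \prod_t M (s t) t.
Proof.
transitivity (\sum_(e : {ffun T -> bool}) \sum_(f : {ffun T -> T})
    ((\prod_a (-1) ^+ (~~ e a)) * \prod_t (e (f t))%:R) * \prod_t M (f t) t).
  apply: eq_bigr => e _.
  rewrite (bigA_distr_bigA (fun t a => (e a)%:R * M a t)) mulr_sumr.
  by apply: eq_bigr => f _; rewrite big_split mulrA.
rewrite exchange_big /=.
under eq_bigr => f _ do rewrite -mulr_suml.
(* The signed sum factors over the points of [T]: a point in the image of [f] contributes 1 + 0, any
   other point 1 - 1. Only surjective [f] survive, that is, permutations. *)
have onto (f : {ffun T -> T}) : \sum_(e : {ffun T -> bool}) (\prod_a (-1) ^+ (~~ e a)) *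
    (\prod_t (e (f t))%:R) = [forall a, a \in codom f]%:R :> R.
  pose w a (b : bool) : R := ((-1) ^+ (~~ b)) * (if a \in codom f then b%:R else 1).
  transitivity (\sum_(e : {ffun T -> bool}) \prod_a w a (e a)).
    apply: eq_bigr => e _; rewrite /w big_split /=; congr (_ * _).
    have [t /negbTE eft|all_e] := pickP (fun t => ~~ e (f t)).
      rewrite (bigD1 t) //= eft mul0r (bigD1 (f t)) //=.
      by rewrite codom_f eft mul0r.
    rewrite big1 => [|t _]; last by move/negbFE: (all_e t) => ->.
    rewrite big1 // => a _; case: ifP => // /codomP [t ->].
    by move/negbFE: (all_e t) => ->.
  rewrite -bigA_distr_bigA.
  have wE a : \sum_b w a b = (a \in codom f)%:R.
    by rewrite big_bool /w /=; case: ifP => _; rewrite !mul1r ?mulr0 ?addr0 // mulr1 subrr.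
  under eq_bigr do rewrite wE.
  case: forallP => [ontof|/forallP/forallPn [a /negbTE na]].
    by rewrite big1 // => a _; rewrite ontof.
  by rewrite (bigD1 a) //= na mul0r.
under eq_bigr => f _ do rewrite onto mulr_natl mulrb.
rewrite -big_mkcond /= sum_ffun_onto; apply: eq_bigr => s _.
by apply: eq_bigr => t _; rewrite pvalE.
Qed.

(** * Schur-Weyl duality *)

Section SchurWeyl.
Variables (F : numClosedFieldType) (T : finType) (N : nat).
Local Notation X := {ffun T -> 'I_N}.
Implicit Types (c : X -> X -> F) (x y z u w : X) (s : {perm T}).

Definition tensor_pow (g : 'M[F]_N) x y : F := \prod_t g (x t) (y t).

Definition ffun_perm x s : X := [ffun t => x (s t)].

(** The matrix h - t is invertible unless [t] is a root of [char_poly h]. So the defect [p], a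
    polynomial in [t], has a product with [char_poly h] that vanishes everywhere; hence [p = 0], and
    t = 0 gives the claim. *)
Lemma comm_tensor_pow c :
  (forall g, g \in unitmx -> forall x z,
     \sum_y c x y * tensor_pow g y z = \sum_y tensor_pow g x y * c y z) ->
  forall h x z,
    \sum_y c x y * tensor_pow h y z = \sum_y tensor_pow h x y * c y z.
Proof.
move=> cP h x z.
pose q y u : {poly F} := \prod_t ((h (y t) (u t))%:P - ((y t == u t)%:R)%:P * 'X).
have qE y u t : (q y u).[t] = tensor_pow (h - t%:M) y u.
  rewrite /q horner_prod; apply: eq_bigr => i _.
  by rewrite !hornerE !mxE mulr_natl.
pose p := \sum_y (c x y)%:P * q y z - \sum_y q x y * (c y z)%:P.
have pE t : p.[t] = \sum_y c x y * tensor_pow (h - t%:M) y z -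
                    \sum_y tensor_pow (h - t%:M) x y * c y z.
  rewrite /p hornerD hornerN !horner_sum; congr (_ - _);
  by apply: eq_bigr => y _; rewrite hornerM hornerC qE.
have: p * char_poly h = 0.
  apply: poly_eq0_horner => t; rewrite hornerM.
  have [->|nz] := eqVneq (char_poly h).[t] 0; first by rewrite mulr0.
  suff u : h - t%:M \in unitmx by rewrite pE cP // subrr mul0r.
  move: nz; rewrite -rootE -eigenvalue_root_char negbK.
  by rewrite /eigenspace kermx_eq0 row_free_unit.
move/eqP; rewrite mulf_eq0 (negbTE (monic_neq0 (char_poly_monic h))) orbF.
by move/eqP=> p0; move: (pE 0); rewrite p0 horner0 raddf0 subr0 => /esym/eqP;
   rewrite subr_eq0 => /eqP.
Qed.

Lemma ffun_permP x y s : (\prod_t (x t == y (s t))%:R : F) = (x == ffun_perm y s)%:R.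
Proof.
case: eqP => [->|/eqP neq]; first by rewrite big1 // => t _; rewrite ffunE eqxx.
have [t nt|eq_xy] := pickP (fun t => x t != y (s t)).
  by rewrite (bigD1 t) //= (negbTE nt) mul0r.
by case/eqP: neq; apply/ffunP => t; rewrite ffunE; apply/eqP/negbFE/eq_xy.
Qed.

Lemma comm_symmetrized c :
  (forall g, g \in unitmx -> forall x z,
     \sum_y c x y * tensor_pow g y z = \sum_y tensor_pow g x y * c y z) ->
  forall x u w z,
    \sum_(s : {perm T}) c x (ffun_perm w s) * (u == ffun_perm z s)%:R
    = \sum_(s : {perm T}) (x == ffun_perm w s)%:R * c (ffun_perm z s) u.
Proof.
move/comm_tensor_pow=> cP x u w z.
(* The sum of the matrix units E_{wa,za} selected by [e]. It may be singular, hence the extension to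
   all matrices by [comm_tensor_pow]. *)
pose h (e : {ffun T -> bool}) : 'M[F]_N :=
  \sum_a (e a)%:R *: delta_mx (w a) (z a).
pose sg (e : {ffun T -> bool}) : F := \prod_a (-1) ^+ (~~ e a).
have sumh x' y' : \sum_e sg e * tensor_pow (h e) x' y' =
    \sum_(s : {perm T}) (x' == ffun_perm w s)%:R * (y' == ffun_perm z s)%:R.
  rewrite -[RHS](_ : \sum_(s : {perm T}) \prod_t ((x' t == w (s t))%:R * (y' t == z (s t))%:R) = _); last first.
    by apply: eq_bigr => s _; rewrite big_split /= !ffun_permP.
  rewrite -(polarization (fun a t => (x' t == w a)%:R * (y' t == z a)%:R)).
  apply: eq_bigr => e _; congr (_ * _); apply: eq_bigr => t _.
  by rewrite summxE; apply: eq_bigr => a _; rewrite !mxE -mulnb natrM.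
transitivity (\sum_e sg e * \sum_y c x y * tensor_pow (h e) y u).
  under [RHS]eq_bigr do rewrite mulr_sumr.
  rewrite [RHS]exchange_big /=.
  transitivity (\sum_y \sum_(s : {perm T})
      c x y * ((y == ffun_perm w s)%:R * (u == ffun_perm z s)%:R)).
    rewrite exchange_big; apply: eq_bigr => s _.
    rewrite (bigD1 (ffun_perm w s)) //= eqxx mul1r big1 ?addr0 //.
    by move=> y /negbTE ->; rewrite mul0r mulr0.
  apply: eq_bigr => y _; rewrite -mulr_sumr -sumh mulr_sumr.
  by apply: eq_bigr => e _; rewrite mulrCA.
under eq_bigr do rewrite cP mulr_sumr.
rewrite exchange_big /=.
transitivity (\sum_y \sum_(s : {perm T})
    (x == ffun_perm w s)%:R * (y == ffun_perm z s)%:R * c y u).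
  apply: eq_bigr => y _; rewrite -mulr_suml -sumh mulr_suml.
  by apply: eq_bigr => e _; rewrite mulrA.
rewrite exchange_big; apply: eq_bigr => s _.
rewrite (bigD1 (ffun_perm z s)) //= eqxx mulr1 big1 ?addr0 //.
by move=> y /negbTE ->; rewrite mulr0 mul0r.
Qed.

(** The rows of [B] are the R_s, flattened. In B = D B^T B, the row of the identity permutation
    writes the identity operator as Phi(Z), with Z the matching row of [D]. *)
Lemma id_gram_perm : exists Z : X -> X -> F, forall x w,
  (x == w)%:R = \sum_(s : {perm T}) (\sum_u \sum_z Z u z * (u == ffun_perm z s)%:R) *
                       (x == ffun_perm w s)%:R.
Proof.
pose B : 'M[F]_(#|{: {perm T}}|, #|{: X * X}|) :=
  \matrix_(i, j) ((enum_val j).1 == ffun_perm (enum_val j).2 (enum_val i))%:R.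
have /submx_gram/submxP[D BE] : forall i j, (B i j)^* = B i j.
  by move=> i j; rewrite mxE conjC_nat.
exists (fun u z => D (enum_rank (1%g : {perm T})) (enum_rank (u, z))) => x w.
have := congr1 (fun M : 'M__ => M (enum_rank (1%g : {perm T})) (enum_rank (x, w))) BE.
rewrite mulmxA mxE !enum_rankK /=.
have -> : ffun_perm w 1 = w by apply/ffunP => t; rewrite ffunE perm1.
move=> ->; rewrite mxE (reindex _ (onW_bij _ (@enum_rank_bij {perm T}))) /=.
apply: eq_bigr => s _; rewrite [in LHS]mxE [B _ _]mxE !enum_rankK /=; congr (_ * _).
rewrite (reindex _ (onW_bij _ (@enum_rank_bij (X * X)%type))) /= pair_big /=.
by apply: eq_bigr => -[u z] _; rewrite [B^T _ _]mxE mxE !enum_rankK.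
Qed.

Lemma schur_weyl c :
  (forall g, g \in unitmx -> forall x z,
     \sum_y c x y * tensor_pow g y z = \sum_y tensor_pow g x y * c y z) ->
  exists alpha : {perm T} -> F,
    forall x w, c x w = \sum_(s : {perm T}) alpha s * (x == ffun_perm w s)%:R.
Proof.
move=> /comm_symmetrized cP; have [Z ZP] := id_gram_perm.
(* This coefficient is the pairing <cZ, R_s>. *)
exists (fun s => \sum_u \sum_z Z u z * c (ffun_perm z s) u) => x w.
have -> : c x w = \sum_y c x y * (y == w)%:R.
  by rewrite (bigD1 w) //= eqxx mulr1 big1 ?addr0 // => y /negbTE ->; rewrite mulr0.
under eq_bigr do rewrite ZP mulr_sumr.
rewrite exchange_big /=.
transitivity (\sum_(s : {perm T}) \sum_u \sum_z Z u z * (c x (ffun_perm w s) * (u == ffun_perm z s)%:R)).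
  apply: eq_bigr => s _; rewrite (bigD1 (ffun_perm w s)) //= [X in _ + X]big1 ?addr0; last first.
    by move=> y /negbTE ->; rewrite !mulr0.
  rewrite eqxx mulr1 mulr_sumr; apply: eq_bigr => u _; rewrite mulr_sumr.
  by apply: eq_bigr => z _; rewrite mulrCA.
have swap (G : X -> X -> {perm T} -> F) :
    \sum_(s : {perm T}) \sum_u \sum_z G u z s = \sum_u \sum_z \sum_(s : {perm T}) G u z s.
  by rewrite exchange_big; apply: eq_bigr => u _; rewrite exchange_big.
(* Here [cP] turns c Phi(Z) into Phi(c Z). *)
rewrite swap; under eq_bigr => u _ do under eq_bigr => z _ do rewrite -mulr_sumr cP mulr_sumr.
rewrite -swap; apply: eq_bigr => s _; rewrite mulr_suml; apply: eq_bigr => u _.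
by rewrite mulr_suml; apply: eq_bigr => z _; rewrite mulrCA mulrC.
Qed.

End SchurWeyl.

Lemma mulmx_cV_inj (R : pzRingType) p q (A B : 'M[R]_(p, q)) :
  (forall v : 'cV_q, A *m v = B *m v) -> A = B.
Proof.
move=> AB; apply/matrixP => i j.
have := congr1 (fun w : 'cV_p => w i 0) (AB (delta_mx j 0)).
by rewrite -!colE !mxE.
Qed.

(** * Mixed tensors and the action of GL(N) *)

Section MixedTensors.
Variables (F : numClosedFieldType) (m n N : nat).
Local Notation idx := (tidx m n N).
Local Notation X := {ffun 'I_m + 'I_n -> 'I_N}.
Implicit Types (v : tvec F m n N) (c A P : tend F m n N) (x y : idx).

Lemma upd_eq k (f : {ffun 'I_k -> 'I_N}) a i : upd f a i a = i.
Proof. by rewrite ffunE eqxx. Qed.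

Lemma upd_neq k (f : {ffun 'I_k -> 'I_N}) a i b : b != a -> upd f a i b = f b.
Proof. by rewrite ffunE => /negbTE->. Qed.

Lemma upd_upd k (f : {ffun 'I_k -> 'I_N}) a i j : upd (upd f a i) a j = upd f a j.
Proof. by apply/ffunP => b; rewrite !ffunE; case: (b == a). Qed.

Lemma upd_id k (f : {ffun 'I_k -> 'I_N}) a : upd f a (f a) = f.
Proof. by apply/ffunP => b; rewrite !ffunE; case: eqP => [->|]. Qed.

Lemma tcoord_mulmx A v x :
  tcoord (A *m v) x = \sum_y A (enum_rank x) (enum_rank y) * tcoord v y.
Proof.
by rewrite /tcoord mxE (reindex _ (onW_bij _ (@enum_rank_bij idx))).
Qed.

(** Group the indices [y] by their entries outside slots [a] and [b], which [r] records by resetting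
    both slots to a base value [i0]. On each class [h] is constant, and the delta leaves one
    contraction of [v]. *)
Lemma in_ker_tr_contract a b v (h : idx -> F) :
    in_ker_tr a b v ->
    (forall x i j, h (upd x.1 a i, upd x.2 b j) = h x) ->
  \sum_y h y * (y.1 a == y.2 b)%:R * tcoord v y = 0.
Proof.
move=> v0 hP.
have [i0 _|noN] := pickP (fun _ : 'I_N => true); last first.
  by apply: big1 => y _; have := noN (y.1 a).
pose r y : idx := (upd y.1 a i0, upd y.2 b i0).
rewrite (partition_big r xpredT) //=; apply: big1 => x _.
transitivity (\sum_(y | (r y == x) && (y.1 a == y.2 b)) h y * tcoord v y).
  rewrite [RHS]big_mkcondr; apply: eq_bigr => y _.
  by case: eqP; rewrite ?mulr1 // mulr0 mul0r.
pose q i : idx := (upd x.1 a i, upd x.2 b i).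
rewrite (reindex_onto q (fun y => y.1 a)) => [|y /andP[/eqP rx /eqP ab]]; last first.
  by rewrite /q -rx /= !upd_upd {2}ab !upd_id -surjective_pairing.
rewrite (eq_bigl (fun i => r x == x)) => [|i]; last first.
  by rewrite /r /= !upd_upd !upd_eq !eqxx !andbT.
under eq_bigr do rewrite hP.
by case: (r x == x); rewrite ?big_pred0_eq // -mulr_sumr v0 mulr0.
Qed.

Lemma rhoE (g : 'M[F]_N) x y :
  rho m n g (enum_rank x) (enum_rank y) =
  tensor_pow g x.1 y.1 * tensor_pow (invmx g) y.2 x.2.
Proof. by rewrite mxE !enum_rankK. Qed.

Lemma trmx_rho (g : 'M[F]_N) : (rho m n g)^T = rho m n g^T.
Proof.
apply/matrixP => i j; rewrite !mxE -trmx_inv.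
by congr (_ * _); apply: eq_bigr => k _; rewrite mxE.
Qed.

(** The entries of [g] at slot [a] and of g^{-1} at slot [b], summed over [i], give a delta; the
    other entries form the weight [h] of [in_ker_tr_contract]. *)
Lemma rho_traceless (g : 'M[F]_N) v :
  g \in unitmx -> traceless v -> traceless (rho m n g *m v).
Proof.
move=> g_unit v0 a b x.
pose h y : F := (\prod_(a' | a' != a) g (x.1 a') (y.1 a')) *
                \prod_(b' | b' != b) invmx g (y.2 b') (x.2 b').
under eq_bigr do rewrite tcoord_mulmx.
rewrite exchange_big /= -[RHS](@in_ker_tr_contract a b v h) //; last first.
  move=> y i j; rewrite /h /=; congr (_ * _).
    by apply: eq_bigr => k /upd_neq ->.
  by apply: eq_bigr => k /upd_neq ->.
apply: eq_bigr => y _; rewrite -mulr_suml; congr (_ * _).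
have -> : (y.1 a == y.2 b)%:R = \sum_i invmx g (y.2 b) i * g i (y.1 a).
  have := congr1 (fun M : 'M_N => M (y.2 b) (y.1 a)) (mulVmx g_unit).
  by rewrite !mxE eq_sym => <-.
rewrite mulr_sumr; apply: eq_bigr => i _; rewrite rhoE /=.
rewrite /tensor_pow (bigD1 a) //= [X in _ * X](bigD1 b) //= !upd_eq.
rewrite mulrACA mulrC [g _ _ * _]mulrC /h.
by congr (_ * _ * _); apply: eq_bigr => k /upd_neq ->.
Qed.

Lemma centralizer_trmx c : centralizer c -> centralizer c^T.
Proof.
move=> cC g g_unit; rewrite -[g]trmxK -trmx_rho -!trmx_mul.
by rewrite cC // unitmx_tr.
Qed.

(** * Partial transposition and walled Brauer diagrams *)

Definition tjoin (f : {ffun 'I_m -> 'I_N}) (f' : {ffun 'I_n -> 'I_N}) : X :=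
  [ffun t => match t with inl a => f a | inr b => f' b end].

Definition tleft (z : X) : {ffun 'I_m -> 'I_N} := [ffun a => z (inl a)].
Definition tright (z : X) : {ffun 'I_n -> 'I_N} := [ffun b => z (inr b)].

Lemma tjoin_left f f' : tleft (tjoin f f') = f.
Proof. by apply/ffunP => a; rewrite !ffunE. Qed.

Lemma tjoin_right f f' : tright (tjoin f f') = f'.
Proof. by apply/ffunP => a; rewrite !ffunE. Qed.

Lemma tjoinK z : tjoin (tleft z) (tright z) = z.
Proof. by apply/ffunP => -[a|b]; rewrite !ffunE. Qed.

Lemma tjoin_updl f f' a i t : t != inl a -> tjoin (upd f a i) f' t = tjoin f f' t.
Proof. by case: t => k neq; rewrite !ffunE //; case: eqP => // kE; rewrite kE eqxx in neq. Qed.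

Lemma tjoin_updr f f' b i t : t != inr b -> tjoin f (upd f' b i) t = tjoin f f' t.
Proof. by case: t => k neq; rewrite !ffunE //; case: eqP => // kE; rewrite kE eqxx in neq. Qed.

Lemma sum_tjoin (G : X -> F) : \sum_z G z = \sum_f \sum_f' G (tjoin f f').
Proof.
rewrite pair_big (reindex (fun p => tjoin p.1 p.2)) //=.
exists (fun z => (tleft z, tright z)) => [[f f'] _|z _] /=; last exact: tjoinK.
by rewrite tjoin_left tjoin_right.
Qed.

Lemma tensor_pow_tjoin (g : 'M[F]_N) z w :
  tensor_pow g z w = tensor_pow g (tleft z) (tleft w) * tensor_pow g (tright z) (tright w).
Proof.
by rewrite /tensor_pow big_sumType; congr (_ * _); apply: eq_bigr => k _; rewrite !ffunE.
Qed.

Lemma tensor_powM (T : finType) (g h : 'M[F]_N) (x z : {ffun T -> 'I_N}) :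
  \sum_y tensor_pow g x y * tensor_pow h y z = tensor_pow (g *m h) x z.
Proof.
rewrite /tensor_pow; under [RHS]eq_bigr do rewrite mxE.
rewrite (bigA_distr_bigA (fun t i => g (x t) i * h i (z t))).
by apply: eq_bigr => y _; rewrite big_split.
Qed.

Lemma tensor_pow1 (T : finType) (x z : {ffun T -> 'I_N}) :
  tensor_pow (1%:M : 'M[F]_N) x z = (x == z)%:R.
Proof.
rewrite -[z in RHS](_ : ffun_perm z 1 = z); last by apply/ffunP => t; rewrite ffunE perm1.
by rewrite -ffun_permP; apply: eq_bigr => t _; rewrite mxE perm1.
Qed.

(* Partial transposition, exchanging the V* indices of row and column: it turns an
   endomorphism of V^{m,n} into one of V^{(x)(m+n)}. *)
Definition ptrans c (z w : X) : F :=
  c (enum_rank (tleft z, tright w)) (enum_rank (tleft w, tright z)).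

(** Cancels [B] against a row or column [w] of its inverse; applied below to tensor powers of g^{-1}
    and [g]. *)
Lemma sum_delta (I J L : finType) (w : I -> F) (A : J -> L -> F) (B : I -> L -> F) l0 :
  (forall l, \sum_i w i * B i l = (l == l0)%:R) ->
  \sum_i w i * (\sum_j \sum_l A j l * B i l) = \sum_j A j l0.
Proof.
move=> wB; under eq_bigr do rewrite mulr_sumr.
rewrite exchange_big /=; apply: eq_bigr => j _.
under eq_bigr do rewrite mulr_sumr.
rewrite exchange_big /= (bigD1 l0) //= [X in _ + X]big1 => [|l /negbTE l_l0].
  by under eq_bigr do rewrite mulrCA; rewrite -mulr_sumr wB eqxx mulr1 addr0.
by under eq_bigr do rewrite mulrCA; rewrite -mulr_sumr wB l_l0 mulr0.
Qed.

(** Commutation with rho(g) has g^{-1} on the dual indices. Multiplying by g(L,L') g(J,J') and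
    summing over L' and J cancels g^{-1} on each side and leaves [g] acting on the exchanged dual
    indices. *)
Lemma ptrans_comm c : centralizer c ->
  forall g, g \in unitmx -> forall z w,
  \sum_y ptrans c z y * tensor_pow g y w = \sum_y tensor_pow g z y * ptrans c y w.
Proof.
move=> cC g g_unit z w.
set I := tleft z; set L := tright z; set K' := tleft w; set J' := tright w.
pose cc f f' k k' := c (enum_rank (f, f')) (enum_rank (k, k')).
have cE J L' :
    \sum_K \sum_L1 (cc I J K L1 * tensor_pow g K K') * tensor_pow (invmx g) L' L1
    = \sum_K \sum_L1 (tensor_pow g I K * cc K L1 K' L') * tensor_pow (invmx g) L1 J.
  have := congr1 (fun M : 'M_ _ => M (enum_rank (I, J)) (enum_rank (K', L'))) (cC g g_unit).
  rewrite !mxE !(reindex _ (onW_bij _ (@enum_rank_bij idx))) /= => E.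
  rewrite !pair_big /=; transitivity (\sum_(y : idx) c (enum_rank (I, J)) (enum_rank y) *
      rho m n g (enum_rank y) (enum_rank (K', L'))).
    by apply: eq_bigr => -[k l] _; rewrite rhoE /= mulrA.
  by rewrite E; apply: eq_bigr => -[k l] _; rewrite rhoE /= mulrAC.
rewrite !sum_tjoin.
transitivity (\sum_J \sum_L' tensor_pow g J J' * (tensor_pow g L L' *
   \sum_K \sum_L1 (cc I J K L1 * tensor_pow g K K') * tensor_pow (invmx g) L' L1)).
  rewrite exchange_big; apply: eq_bigr => J _; rewrite -mulr_sumr (@sum_delta _ _ _ _ _ _ L).
    rewrite mulr_sumr; apply: eq_bigr => K _.
    by rewrite /ptrans tensor_pow_tjoin !tjoin_left !tjoin_right mulrA mulrC.
  by move=> l; rewrite tensor_powM mulmxV // tensor_pow1 eq_sym.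
transitivity (\sum_L' \sum_J tensor_pow g L L' * (tensor_pow g J J' *
   \sum_K \sum_L1 (tensor_pow g I K * cc K L1 K' L') * tensor_pow (invmx g) L1 J)).
  rewrite exchange_big; apply: eq_bigr => L' _; apply: eq_bigr => J _.
  by rewrite cE mulrCA.
rewrite [RHS]exchange_big; apply: eq_bigr => L' _.
rewrite -mulr_sumr (@sum_delta _ _ _ _ _ _ J') => [|l]; last first.
  by under eq_bigr do rewrite mulrC; rewrite tensor_powM mulVmx // tensor_pow1.
rewrite mulr_sumr; apply: eq_bigr => K _.
by rewrite /ptrans tensor_pow_tjoin !tjoin_left !tjoin_right mulrCA mulrA.
Qed.

(* The permutation [s] is a walled Brauer diagram. If it contracts two input
   slots, it kills traceless tensors; otherwise it permutes the slots of each
   kind and carries a contraction of the output back to one of the input. *)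
Lemma diagram_traceless (s : {perm 'I_m + 'I_n}) v a b x : traceless v ->
  \sum_i \sum_y (tjoin (upd x.1 a i) y.2 ==
                 ffun_perm (tjoin y.1 (upd x.2 b i)) s)%:R * tcoord v y = 0.
Proof.
move=> v0; case: (pickP (fun b0 => if s (inr b0) is inl _ then true else false)).
  move=> b0; case sb0: (s (inr b0)) => [a0|//] _; apply: big1 => i _.
  pose h y : F := \prod_(t | t != inr b0)
    (tjoin (upd x.1 a i) y.2 t == tjoin y.1 (upd x.2 b i) (s t))%:R.
  rewrite -[RHS](@in_ker_tr_contract a0 b0 v h) //.
    apply: eq_bigr => y _; congr (_ * _).
    rewrite -ffun_permP (bigD1 (inr b0)) //= mulrC sb0; congr (_ * _).
    by rewrite !ffunE eq_sym.
  move=> y j k; apply: eq_bigr => t tb0; rewrite /= tjoin_updr // (tjoin_updl y.1) //.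
  by rewrite -sb0 (inj_eq perm_inj).
move=> s_inr.
(* No V* slot goes to a V slot, so by finiteness [s] permutes the V* slots, and therefore the V
   slots: [b] comes from some [b1], and [a] goes to some [a1]. *)
have [f fP] : exists f : 'I_n -> 'I_n, forall b0, s (inr b0) = inr (f b0).
  exists (fun b0 => if s (inr b0) is inr b1 then b1 else b0) => b0.
  by have := s_inr b0; case: (s (inr b0)).
have f_inj : injective f.
  by move=> b0 b1 eq_f; apply/inr_inj/(@perm_inj _ s); rewrite !fP eq_f.
have /codomP[b1 bE] := injF_onto f_inj b.
have [a1 sa] : exists a1, s (inl a) = inl a1.
  case sa: (s (inl a)) => [a1|b2]; first by exists a1.
  have /codomP[b3 b2E] := injF_onto f_inj b2.
  by move: sa; rewrite b2E -fP => /perm_inj.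
pose h y : F := \prod_(t | (t != inl a) && (t != inr b1))
  (tjoin x.1 y.2 t == tjoin y.1 x.2 (s t))%:R.
rewrite exchange_big -[RHS](@in_ker_tr_contract a1 b1 v h) //=; last first.
  move=> y j k; apply: eq_bigr => t /andP[ta tb]; rewrite /= tjoin_updr // tjoin_updl //.
  by rewrite -sa (inj_eq perm_inj).
apply: eq_bigr => y _; rewrite -mulr_suml; congr (_ * _).
(* The slots [inl a] and [inr b1] force i = y.1 a1 and y.2 b1 = i, so summing over [i] leaves the
   delta that contracts [a1] with [b1]. *)
transitivity (\sum_i h y * ((i == y.1 a1)%:R * (y.2 b1 == i)%:R)).
  apply: eq_bigr => i _; rewrite -ffun_permP (bigD1 (inl a)) //= (bigD1 (inr b1)) //=.
  rewrite mulrA mulrC sa fP -bE; congr (_ * _); last first.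
    by rewrite !ffunE !eqxx.
  apply: eq_bigr => t /andP[ta tb]; rewrite tjoin_updl // tjoin_updr //.
  by rewrite bE -fP (inj_eq perm_inj).
rewrite -mulr_sumr (bigD1 (y.1 a1)) //= eqxx mul1r big1 ?addr0 => [|i /negbTE ->].
  by rewrite eq_sym.
by rewrite mul0r.
Qed.

Lemma centralizer_traceless c v :
  centralizer c -> traceless v -> traceless (c *m v).
Proof.
move=> /ptrans_comm/schur_weyl[alpha alphaP] v0 a b x.
have cE x' y : c (enum_rank x') (enum_rank y) = ptrans c (tjoin x'.1 y.2) (tjoin y.1 x'.2).
  by rewrite /ptrans !tjoin_left !tjoin_right -!surjective_pairing.
transitivity (\sum_s alpha s * \sum_i \sum_y
    (tjoin (upd x.1 a i) y.2 == ffun_perm (tjoin y.1 (upd x.2 b i)) s)%:R * tcoord v y).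
  under [RHS]eq_bigr do rewrite mulr_sumr.
  rewrite exchange_big; apply: eq_bigr => i _; rewrite tcoord_mulmx.
  under [RHS]eq_bigr do rewrite mulr_sumr.
  rewrite exchange_big; apply: eq_bigr => y _; rewrite cE alphaP mulr_suml.
  by apply: eq_bigr => s _; rewrite mulrA.
by apply: big1 => s _; rewrite diagram_traceless ?mulr0.
Qed.

(** * Trace functionals and the traceless projector *)

Definition trace_mx : 'M[F]_(#|{: 'I_m * 'I_n * idx}|, tdim m n N) :=
  \matrix_(i, j) let: (a, b, x) := enum_val i in
    \sum_k (enum_val j == (upd x.1 a k, upd x.2 b k) :> idx)%:R.

Lemma trace_mxE a b x v :
  (trace_mx *m v) (enum_rank (a, b, x)) 0 =
  \sum_k tcoord v (upd x.1 a k, upd x.2 b k).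
Proof.
rewrite mxE (reindex _ (onW_bij _ (@enum_rank_bij idx))) /=.
under eq_bigr do rewrite mxE !enum_rankK mulr_suml.
rewrite exchange_big; apply: eq_bigr => k _ /=.
rewrite (bigD1 (upd x.1 a k, upd x.2 b k)) //= eqxx mul1r big1 ?addr0 //.
by move=> y /negbTE ->; rewrite mul0r.
Qed.

Lemma tracelessP v : traceless v <-> trace_mx *m v = 0.
Proof.
split=> [v0|Bv a b x]; last by rewrite -trace_mxE Bv mxE.
apply/matrixP => i j; rewrite ord1 [RHS]mxE -[i]enum_valK.
by case: (enum_val i) => [[a b] x]; rewrite trace_mxE v0.
Qed.

(** Puts a column of the transposed [trace_mx] in the form asked by [in_img_trplus]. The last factor
    tests whether [x] and [y] agree outside slots [a] and [b], by overwriting both slots with the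
    value [x.1 a]. *)
Lemma sum_trace_delta a b x y :
  \sum_k (y == (upd x.1 a k, upd x.2 b k))%:R =
  (y.1 a == y.2 b)%:R * ((upd y.1 a (x.1 a), upd y.2 b (x.1 a)) ==
                         (x.1, upd x.2 b (x.1 a)))%:R :> F.
Proof.
have [k /eqP ->|none] := pickP (fun k => y == (upd x.1 a k, upd x.2 b k)).
  rewrite /= !upd_eq !upd_upd upd_id !eqxx mul1r (bigD1 k) //= eqxx big1 ?addr0 //.
  move=> j /negbTE jk; case: eqP => // -[/ffunP/(_ a)].
  by rewrite !upd_eq => kj; rewrite kj eqxx in jk.
rewrite big1 => [|k _]; last by rewrite none.
case: eqP => [ab|]; last by rewrite mul0r.
case: eqP => [[E1 E2]|]; last by rewrite mulr0.
have y1 : upd x.1 a (y.1 a) = y.1 by rewrite -E1 upd_upd upd_id.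
have y2 : upd x.2 b (y.1 a) = y.2.
  by rewrite -(upd_upd x.2 b (x.1 a)) -E2 upd_upd ab upd_id.
by have := none (y.1 a); rewrite y1 y2 -surjective_pairing eqxx.
Qed.

Lemma trace_part_col i : trace_part (trace_mx^T *m delta_mx i 0).
Proof.
rewrite -colE -[i]enum_valK; case: (enum_val i) => [[a b] x].
set u := col _ _.
exists (fun a' b' => if (a' == a) && (b' == b) then u else 0); split.
  move=> a' b'; case: ifP => [/andP[/eqP -> /eqP ->]|_]; last first.
    by exists (fun=> 0); split=> // y; rewrite mulr0 /tcoord mxE.
  exists (fun y => ((upd y.1 a (x.1 a), upd y.2 b (x.1 a)) ==
                    (x.1, upd x.2 b (x.1 a)))%:R); split.
    by move=> y j k; rewrite /= !upd_upd.
  by move=> y; rewrite /tcoord !mxE !enum_rankK sum_trace_delta.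
rewrite (bigD1 a) //= [X in _ + X]big1 => [|a' /negbTE ->]; last by rewrite big1.
rewrite addr0 (bigD1 b) //= !eqxx /= big1 ?addr0 // => b' /negbTE ->.
by rewrite ?andbF.
Qed.

Section Projector.
Variable P : tend F m n N.
Hypothesis hP : traceless_projector P.

Lemma projector_mul_trace : P *m trace_mx^T = 0.
Proof.
apply/matrixP => i j; have := hP.2 _ (trace_part_col j).
rewrite mulmxA -colE => /(congr1 (fun w : 'cV_ _ => w i 0)).
by rewrite !mxE.
Qed.

(** With B = [trace_mx], [submx_gram] gives B = B B^T D, so Q = 1 - B^T D maps into V_0. Then P Q =
    Q, while P B^T = 0 gives P Q = P. *)
Lemma projector_compl :
  exists2 D, P = 1%:M - trace_mx^T *m D & trace_mx *m P = 0.
Proof.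
have /submx_gram/submxP[D] : forall i j, (trace_mx^T i j)^* = trace_mx^T i j.
  move=> i j; rewrite !mxE; case: (enum_val j) => [[a b] x].
  by rewrite rmorph_sum; apply: eq_bigr => k _; apply: conjC_nat.
move/(congr1 trmx); rewrite !trmx_mul !trmxK => BE.
have B0 : trace_mx *m (1%:M - trace_mx^T *m D^T) = 0.
  by rewrite mulmxBr mulmx1 mulmxA -BE subrr.
suff PE : P = 1%:M - trace_mx^T *m D^T by exists D^T => //; rewrite PE.
apply: mulmx_cV_inj => v.
have /hP.1 : traceless ((1%:M - trace_mx^T *m D^T) *m v).
  by apply/tracelessP; rewrite mulmxA B0 mul0mx.
by rewrite mulmxA mulmxBr mulmx1 mulmxA projector_mul_trace mul0mx subr0.
Qed.

Lemma projector_traceless v : traceless (P *m v).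
Proof.
by have [D _ B0] := projector_compl; apply/tracelessP; rewrite mulmxA B0 mul0mx.
Qed.

Lemma projector_mul_traceless A : trace_mx *m A = 0 -> P *m A = A.
Proof.
move=> A0; apply: mulmx_cV_inj => v; rewrite -mulmxA; apply: hP.1.
by apply/tracelessP; rewrite mulmxA A0 mul0mx.
Qed.

Lemma projector_idem : P *m P = P.
Proof. by have [D _ B0] := projector_compl; apply: projector_mul_traceless. Qed.

(** With B = [trace_mx], the columns of P^T are traceless, since B P^T = (P B^T)^T = 0. Hence P P^T
    = P^T, and the left side is symmetric. *)
Lemma projector_sym : P^T = P.
Proof.
have PPt : P *m P^T = P^T.
  apply: projector_mul_traceless.
  by rewrite -[trace_mx]trmxK -trmx_mul projector_mul_trace trmx0.
by rewrite -[RHS]trmxK -PPt trmx_mul trmxK.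
Qed.

(* Since [P] is symmetric, stability of the traceless subspace under [A^T]
   amounts to stability of the trace part under [A]. *)
Lemma projector_comm A :
  (forall v, traceless v -> traceless (A *m v)) ->
  (forall v, traceless v -> traceless (A^T *m v)) -> P *m A = A *m P.
Proof.
have stab A' : (forall v, traceless v -> traceless (A' *m v)) ->
    P *m A' *m P = A' *m P.
  move=> A'0; apply: mulmx_cV_inj => v; rewrite -!mulmxA; apply: hP.1.
  exact/A'0/projector_traceless.
move=> /stab AP /stab /(congr1 trmx); rewrite !trmx_mul !trmxK projector_sym => PA.
by rewrite -AP -mulmxA.
Qed.

Lemma projector_centralizer : centralizer P.
Proof.
move=> g g_unit; apply: projector_comm => v; first exact: rho_traceless.
by rewrite trmx_rho; apply: rho_traceless; rewrite unitmx_tr.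
Qed.

Lemma projector_central c : centralizer c -> P *m c = c *m P.
Proof.
move=> cC; apply: projector_comm => v; first exact: centralizer_traceless.
exact/centralizer_traceless/centralizer_trmx.
Qed.

(** Centrality turns P c into c P, which vanishes iff [c] kills the image V_0 of [P]. *)
Lemma annihilatorP c : centralizer c -> P *m c = 0 <-> annihilator_traceless c.
Proof.
move=> cC; rewrite projector_central //; split=> [cP|[_ c0]].
  by split=> // v /hP.1 <-; rewrite mulmxA cP mul0mx.
by apply: mulmx_cV_inj => v; rewrite -mulmxA mul0mx; apply/c0/projector_traceless.
Qed.

End Projector.

(** * The centralizer algebra and its decomposition *)

Lemma centralizer_mul c c' : centralizer c -> centralizer c' -> centralizer (c *m c').
Proof. by move=> cC c'C g gu; rewrite -mulmxA c'C // mulmxA cC // mulmxA. Qed.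

Lemma centralizer_lin (k : F) c c' :
  centralizer c -> centralizer c' -> centralizer (k *: c + c').
Proof.
by move=> cC c'C g gu; rewrite mulmxDl mulmxDr -scalemxAl -scalemxAr cC // c'C.
Qed.

Lemma centralizer0 : centralizer (0 : tend F m n N).
Proof. by move=> g _; rewrite mulmx0 mul0mx. Qed.

Lemma centralizer1 : centralizer (1%:M : tend F m n N).
Proof. by move=> g _; rewrite mulmx1 mul1mx. Qed.

End MixedTensors.

Theorem theorem3p1 (F : numClosedFieldType) (m n N : nat)
  (hm : (0 < m)%N) (hn : (0 < n)%N) (hN : (0 < N)%N)
  (P : tend F m n N) (hP : traceless_projector P) :
  let C := @centralizer F m n N in
  let J := @annihilator_traceless F m n N in
  let PC := left_mul_image P in
  (* P is a central idempotent of C *)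
  [/\ C P, P *m P = P & forall c, C c -> P *m c = c *m P] /\
  (* P C and J are two-sided ideals of C *)
  two_sided_ideal C PC /\ two_sided_ideal C J /\
  (* C = P C (+) J as a direct sum of algebras *)
  [/\ forall c, C c -> exists x y, [/\ PC x, J y & c = x + y],
      forall x, PC x -> J x -> x = 0
    & forall x y, PC x -> J y -> x *m y = 0 /\ y *m x = 0] /\
  (* P C ~= C / J as algebras, via the surjective algebra map
     C -> P C, c |-> P c, whose kernel is J (P is the unit of P C) *)
  [/\ forall x, PC x -> P *m x = x /\ x *m P = x,
      forall (k : F) a b, C a -> C b -> P *m (k *: a + b) = k *: (P *m a) + P *m b,
      forall a b, C a -> C b -> P *m (a *m b) = (P *m a) *m (P *m b)
    & P *m 1%:M = P] /\
  [/\ forall x, PC x <-> exists c, C c /\ P *m c = x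
    & forall c, C c -> (P *m c = 0 <-> J c)].
Proof.
move=> C J PC.
have CP : C P := projector_centralizer hP.
have PP : P *m P = P := projector_idem hP.
have Pc c : C c -> P *m c = c *m P := projector_central hP (c := c).
have JP c : C c -> (P *m c = 0 <-> J c) := annihilatorP hP (c := c).
have PC_C x : PC x -> C x by move=> [c [Cc ->]]; apply: centralizer_mul.
have PCl x : PC x -> P *m x = x by move=> [c [_ ->]]; rewrite mulmxA PP.
have JC y : J y -> C y by case.
have J0 y : J y -> P *m y = 0 by move=> Jy; apply/JP => //; apply: JC.
(* Write x = P x = x P; the factor [P] passes to [y], and P y = y P = 0. *)
have PCJ x y : PC x -> J y -> x *m y = 0 /\ y *m x = 0.
  move=> PCx Jy; rewrite -(PCl x PCx).
  have Cx := PC_C x PCx; have Cy := JC y Jy.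
  by rewrite {1}(Pc x Cx) mulmxA -mulmxA J0 // mulmx0 -(Pc y Cy) J0 // mul0mx.
split; first by split.
split.
  split=> [||k x y [c [Cc ->]] [d [Cd ->]]|c x Cc [d [Cd ->]]].
  - exact: PC_C.
  - by exists 0; split; [apply: centralizer0 | rewrite mulmx0].
  - exists (k *: c + d); split; first exact: centralizer_lin.
    by rewrite mulmxDr -scalemxAr.
  - split; first exists (c *m d); last exists (d *m c).
      by split; [apply: centralizer_mul | rewrite !mulmxA Pc].
    by split; [apply: centralizer_mul | rewrite mulmxA].
split.
  split=> [||k x y Jx Jy|c x Cc Jx].
  - exact: JC.
  - by apply/JP; [apply: centralizer0 | rewrite mulmx0].
  - apply/JP; first by apply: centralizer_lin; apply: JC.
    by rewrite mulmxDr -scalemxAr !J0 // scaler0 addr0.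
  - have Cx := JC x Jx; split; apply/JP; try exact: centralizer_mul.
      by rewrite mulmxA Pc // -mulmxA J0 // mulmx0.
    by rewrite mulmxA J0 // mul0mx.
split.
  split=> [c Cc|x PCx Jx|//]; last by rewrite -(PCl x PCx) J0.
  (* The Peirce decomposition for the central idempotent [P]. *)
  exists (P *m c), ((1%:M - P) *m c).
  have CQ : C (1%:M - P).
    rewrite addrC -scaleN1r; apply: centralizer_lin => //; exact: centralizer1.
  split; first by exists c.
    apply/JP; first exact: centralizer_mul.
    by rewrite mulmxA mulmxBr mulmx1 PP subrr mul0mx.
  by rewrite mulmxBl mul1mx addrC subrK.
split.
  split=> [x PCx|k a b _ _|a b Ca _|]; last by rewrite mulmx1.
  - by rewrite -Pc ?PCl //; apply: PC_C.
  - by rewrite mulmxDr -scalemxAr.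
  - by rewrite -mulmxA (mulmxA a) -(Pc a Ca) !mulmxA PP.
split=> // x; split=> [[c [Cc ->]]|[c [Cc <-]]]; by exists c.
Qed.
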